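(* Let $A\in\mathbb{R}^{d\times d}$ be symmetric, $b\in\mathbb{R}^d$ and $R>0$. Let $f(x)=\tfrac12 x^TAx+b^Tx$, let $x^\star\in\arg\min_{\|x\|\le R} f(x)$ be a global minimizer, and let $\lambda^\star$ be the optimal Lagrange multiplier, i.e. the unique real number satisfying $(A+\lambda^\star I)x^\star=-b$, $\lambda^\star\ge\max\{-\lambda_{\min},0\}$ and $\lambda^\star(R-\|x^\star\|)=0$. For an integer $t\ge 1$ let $s_t\in\arg\min_{x\in\mathcal{K}_t(A,b),\ \|x\|\le R} f(x)$. Then for every integer $t\ge1$, $$f(s_t)-f(x^\star)\le 36\,\big[f(0)-f(x^\star)\big]\exp\left\{-4t\sqrt{\frac{\lambda_{\min}+\lambda^\star}{\lambda_{\max}+\lambda^\star}}\right\}$$ and $$f(s_t)-f(x^\star)\le\frac{(\lambda_{\max}-\lambda_{\min})\|x^\star\|^2}{(t-\frac12)^2}\left[4+\frac{\mathbb{1}_{\{\lambda_{\min}<0\}}}{8}\log^2\left(\frac{4\|b\|^2}{(u_{\min}^Tb)^2}\right)\right].$$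
   Context: $\|\cdot\|$ is the Euclidean norm. $\lambda_{\min}\le\lambda_{\max}$ are the smallest and largest eigenvalues of $A$, and $u_{\min}$ is a unit eigenvector of $A$ for $\lambda_{\min}$. The Krylov subspace of order $t$ is $\mathcal{K}_t(A,b)=\mathrm{span}\{b,Ab,\dots,A^{t-1}b\}$. $\mathbb{1}_{\{\lambda_{\min}<0\}}$ equals $1$ if $\lambda_{\min}<0$ and $0$ otherwise. Such a $\lambda^\star$ always exists and is unique. Conventions for degenerate cases: if $\lambda_{\max}+\lambda^\star=0$ (so also $\lambda_{\min}+\lambda^\star=0$) the ratio inside the exponential is read as $0$; if $\lambda_{\min}\ge 0$ the logarithmic term is absent; if $\lambda_{\min}<0$ and $u_{\min}^Tb=0$ the right-hand side of the second bound is read as $+\infty$. *)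

(* Defs.v *)
From mathcomp Require Import all_boot all_order all_algebra.
From mathcomp Require Import reals constructive_ereal sequences exp.

Set Implicit Arguments.
Unset Strict Implicit.
Unset Printing Implicit Defensive.

Import Order.TTheory GRing.Theory Num.Theory.
Local Open Scope ring_scope.

Definition dot (R : realType) (d : nat) (x y : 'cV[R]_d) : R := (x^T *m y) 0 0.

(* MathComp-Analysis's norm on 'cV[R]_d is the sup norm. *)
Definition enorm (R : realType) (d : nat) (x : 'cV[R]_d) : R :=
  Num.sqrt (dot x x).

Definition qobj (R : realType) (d : nat) (A : 'M[R]_d) (b x : 'cV[R]_d) : R :=
  2^-1 * dot x (A *m x) + dot b x.

Definition krylov (R : realType) (d : nat) (A : 'M[R]_d) (b : 'cV[R]_d)
    (t : nat) : {vspace 'cV[R]_d} :=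
  <<mkseq (fun k => A ^+ k *m b) t>>%VS.

(* [eigenvalue] is stated with row eigenvectors; it has the same eigenvalues
   as the column version.  The existence of an eigenvalue forces [0 < d]. *)
Definition is_lambda_min (R : realType) (d : nat) (A : 'M[R]_d) (l : R) : Prop :=
  eigenvalue A l /\ forall a : R, eigenvalue A a -> l <= a.

Definition is_lambda_max (R : realType) (d : nat) (A : 'M[R]_d) (l : R) : Prop :=
  eigenvalue A l /\ forall a : R, eigenvalue A a -> a <= l.

Definition is_unit_eigenvector (R : realType) (d : nat) (A : 'M[R]_d) (l : R)
    (u : 'cV[R]_d) : Prop :=
  A *m u = l *: u /\ enorm u = 1.

Definition is_argmin (R : realType) (T : Type) (D : T -> Prop) (f : T -> R)
    (x : T) : Prop :=
  D x /\ forall y : T, D y -> f x <= f y.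

(* At most one [lam] satisfies this when [0 < rad]: if [x != 0] the first
   equation determines it, and if [x = 0] the last one forces [lam = 0]. *)
Definition is_multiplier (R : realType) (d : nat) (A : 'M[R]_d) (b : 'cV[R]_d)
    (rad lmin : R) (x : 'cV[R]_d) (lam : R) : Prop :=
  [/\ (A + lam%:M) *m x = - b,
      Num.max (- lmin) 0 <= lam
    & lam * (rad - enorm x) = 0].

(* When [lmax + lam = 0] the quotient is [0], since [0^-1 = 0]. *)
Definition linear_rate (R : realType) (lmin lmax lam : R) (t : nat) : R :=
  expR (- 4 * t%:R * Num.sqrt ((lmin + lam) / (lmax + lam))).

(* [ln] and division are total, so the infinite case has to be explicit; the
   indicator factor [(lmin < 0)%:R] removes the logarithm when [0 <= lmin]. *)
Definition sublinear_bound (R : realType) (d : nat) (b x u : 'cV[R]_d)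
    (lmin lmax : R) (t : nat) : \bar R :=
  if (lmin < 0) && (dot u b == 0) then +oo%E
  else ((lmax - lmin) * enorm x ^+ 2 / (t%:R - 2^-1) ^+ 2 *
        (4 + (lmin < 0)%R%:R / 8 *
             ln (4 * enorm b ^+ 2 / dot u b ^+ 2) ^+ 2))%:E.

(* Main.v *)
Require Import Defs.
From mathcomp Require Import all_boot all_order all_algebra.
From mathcomp Require Import boolp classical_sets topology normedtype.
From mathcomp Require Import reals constructive_ereal sequences exp.
From mathcomp Require Import complex zify ring lra.

(* Both bounds exhibit a feasible point of the Krylov space.

   Linear rate: with M = A + lam I we have b = - M xstar, so z = q(M) M xstar
   lies in the Krylov space, and 1 - X q may be taken to be a rescaled
   Chebyshev polynomial, of size at most de = 2 exp(-2 t sqrt(..)) on the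
   spectrum of M.  On the sphere of radius |xstar| the gap f(x) - f(xstar) is
   exactly 1/2 <x - xstar, M (x - xstar)>, so z is rescaled to that sphere;
   the factor 36 comes from assuming de <= 1/3, the bound being trivial
   otherwise.

   Sublinear rate: the objective qobj (A - lmin I) b + max(lmin,0)/2 |x|^2 is
   convex with (lmax - lmin)-smooth quadratic part, and accelerated proximal
   gradient steps for it stay in the Krylov space because the projection on
   the ball is a scaling.  If lmin < 0 the resulting point is moved to the
   sphere along an approximate eigenvector for lmin taken from the Krylov
   space, in the direction in which the linear term decreases. *)

Set Implicit Arguments.
Unset Strict Implicit.
Unset Printing Implicit Defensive.

Import Order.TTheory GRing.Theory Num.Theory.
Local Open Scope ring_scope.

(** * Spectral bounds for symmetric matrices *)

(** Over the complex numbers A is unitarily diagonalised by some P with real spectrum a_i, so the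
    form equals the sum of p(a_i) |(P x)_i|^2. *)
Lemma horner_mx_psd (R : realType) (d : nat) (A : 'M[R]_d.+1) (p : {poly R})
    (x : 'cV[R]_d.+1) :
  A^T = A -> (forall a, eigenvalue A a -> 0 <= p.[a]) ->
  0 <= dot x (horner_mx A p *m x).
Proof.
move=> symA p_ge0; rewrite -lecR.
pose f := real_complex R; pose Ac := map_mx f A.
have Aherm : Ac \is hermsymmx.
  apply: realsym_hermsym.
    apply/is_hermitianmxP; rewrite expr0 scale1r map_mx_id //.
    by rewrite /Ac map_trmx symA.
  apply/mxOverP=> i j; rewrite mxE; exact/complex_realP/ex_intro.
have := hermitian_normalmx Aherm => /orthomx_spectralP.
have := hermitian_spectral_diag_real Aherm.
have Pu := spectral_unitarymx Ac.
set P := spectralmx Ac in Pu *; set sp := spectral_diag Ac => sp_real defA.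
have Pi : P \in unitmx by exact: unitarymx_unit.
(* Row i of P is a left eigenvector, nonzero because P is invertible; being an eigenvalue then
   descends from [Ac] to A. *)
have eig i : exists2 r, sp 0 i = f r & eigenvalue A r.
  have /mxOverP/(_ 0 i)/complex_realP[r spr] := sp_real.
  exists r => //; rewrite -(eigenvalue_map f) -/Ac.
  apply/eigenvalueP; exists (row i P).
    rewrite -row_mul {1}defA mulmxA mulmxA mulmxV // mul1mx row_mul.
    rewrite row_diag_mx -scalemxAl -rowE spr //.
  apply/eqP=> Pi0; have := row_free_unit P; rewrite Pi => /row_freeP[Q QP].
  have /rowP/(_ i) := congr1 (row i) QP.
  by rewrite row_mul Pi0 mul0mx !mxE eqxx => /esym/eqP; rewrite oner_eq0.
have hc : map_mx f (horner_mx A p) =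
    invmx P *m diag_mx (map_mx (horner (map_poly f p)) sp) *m P.
  by rewrite map_horner_mx -/Ac -horner_mx_diag -horner_mx_uconjC // -defA.
have -> : ((dot x (horner_mx A p *m x))%:C)%C =
   \sum_i (map_poly f p).[sp 0 i] * `|(P *m map_mx f x) i 0| ^+ 2.
  have -> : ((dot x (horner_mx A p *m x))%:C)%C =
     (map_mx f (x^T *m (horner_mx A p *m x))) 0 0 by rewrite mxE.
  rewrite !map_mxM hc invmx_unitary // -!mulmxA.
  have -> : map_mx f x^T *m (map_mx Num.conj P^T *m
    (diag_mx (map_mx (horner (map_poly f p)) sp) *m (P *m map_mx f x))) =
    map_mx Num.conj (P *m map_mx f x)^T *m
    (diag_mx (map_mx (horner (map_poly f p)) sp) *m (P *m map_mx f x)).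
    rewrite trmx_mul map_mxM mulmxA; congr (_ *m _ *m _).
    apply/matrixP=> i j; rewrite !mxE /=; apply/esym/CrealP.
    exact/complex_realP/ex_intro.
  rewrite mxE; apply: eq_bigr => i _.
  by rewrite mul_diag_mx !mxE mulrCA normCKC.
apply: sumr_ge0 => i _; have [r -> /p_ge0 pr] := eig i.
by rewrite horner_map mulr_ge0 ?exprn_ge0 // lecR.
Qed.

(** * Chebyshev recurrences *)

(* [cheb y 1 y k] is the Chebyshev polynomial T_k(y), and
   [cheb a 1 (2 * a - 1) k] with a = 2 y^2 - 1 is T_(2k+1)(y) / y. *)
Fixpoint cheb (T : comNzRingType) (y c0 c1 : T) (k : nat) : T :=
  if k is k'.+1 then cheb y c1 (2 * y * c1 - c0) k' else c0.

Lemma chebSS (T : comNzRingType) (y c0 c1 : T) k :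
  cheb y c0 c1 k.+2 = 2 * y * cheb y c0 c1 k.+1 - cheb y c0 c1 k.
Proof. by elim: k c0 c1 => [//|k IH] c0 c1; exact: IH. Qed.

Lemma cheb_horner (T : comNzRingType) (y c0 c1 : {poly T}) k x :
  (cheb y c0 c1 k).[x] = cheb y.[x] c0.[x] c1.[x] k.
Proof.
elim: k c0 c1 => [//|k IH] c0 c1 /=.
by rewrite IH -[2 : {poly T}]polyC_natr !hornerE.
Qed.

Lemma size_cheb (T : comNzRingType) (y c0 c1 : {poly T}) k :
  (size y <= 2)%N -> (size c0 <= 1)%N -> (size c1 <= 2)%N ->
  (size (cheb y c0 c1 k) <= k.+1)%N.
Proof.
move=> sy s0 s1.
suff: (size (cheb y c0 c1 k) <= k.+1)%N && (size (cheb y c0 c1 k.+1) <= k.+2)%N.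
  by case/andP.
elim: k => [|k /andP[IH1 IH2]]; first by rewrite /= s0 s1.
rewrite IH2 andTb chebSS.
rewrite (leq_trans (size_polyD _ _)) // geq_max size_polyN.
rewrite (leq_trans IH1) ?andbT; last first.
  by rewrite !ltnS; lia.
rewrite -mulrA -polyC_natr mul_polyC (leq_trans (size_scale_leq _ _)) //.
rewrite (leq_trans (size_polyMleq _ _)) //.
set n := size (cheb y c0 c1 k.+1) in IH2 *; move: sy IH2; move: (size y) n => m n; lia.
Qed.

(** A Pell-type conserved quantity of the recurrence. It replaces trigonometric formulas in the
    bounds that follow. *)
Lemma cheb_invariant (T : comNzRingType) (y c0 c1 : T) k :
  cheb y c0 c1 k.+1 ^+ 2 - 2 * y * cheb y c0 c1 k.+1 * cheb y c0 c1 k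
    + cheb y c0 c1 k ^+ 2 = c1 ^+ 2 - 2 * y * c1 * c0 + c0 ^+ 2.
Proof.
elim: k => [//|k IH]; rewrite -IH chebSS; ring.
Qed.

Lemma cheb_bound (R : realFieldType) (y c0 c1 : R) k :
  (1 - y ^+ 2) * cheb y c0 c1 k ^+ 2 <= c1 ^+ 2 - 2 * y * c1 * c0 + c0 ^+ 2.
Proof.
rewrite -(cheb_invariant y c0 c1 k) -subr_ge0.
rewrite (_ : _ - _ = (cheb y c0 c1 k.+1 - y * cheb y c0 c1 k) ^+ 2); last ring.
exact: sqr_ge0.
Qed.

Lemma cheb_closed (R : realFieldType) (r s al be y : R) k :
  r * s = 1 -> 2 * y = r + s ->
  cheb y (al + be) (al * r + be * s) k = al * r ^+ k + be * s ^+ k.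
Proof.
move=> rs1 yE.
suff: cheb y (al + be) (al * r + be * s) k = al * r ^+ k + be * s ^+ k /\
  cheb y (al + be) (al * r + be * s) k.+1 = al * r ^+ k.+1 + be * s ^+ k.+1.
  by case.
elim: k => [|k [IH1 IH2]]; first by rewrite /= !expr0 !expr1 !mulr1.
split=> //; rewrite chebSS IH1 IH2 yE !exprS.
rewrite -[in X in _ - X](mulr1 (_ + be * _)) -rs1; ring.
Qed.

Lemma cheb_le1 (R : realFieldType) (y : R) k :
  -1 <= y <= 1 -> `|cheb y 1 y k| <= 1.
Proof.
move=> /andP[y1 y2]; rewrite -(@ler_pXn2r _ 2) ?nnegrE // expr1n real_normK ?num_real //.
have [y2l1|] := ltP (y ^+ 2) 1.
  have y20 : 0 < 1 - y ^+ 2 by lra.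
  rewrite -(ler_pM2l y20); apply: (le_trans (cheb_bound _ _ _ _)); lra.
(* At y = 1 or y = -1 [cheb_bound] is void; both characteristic roots equal y and the value is
   y^k. *)
move=> y2g1; have y21 : y * y = 1 by nra.
have := @cheb_closed R y y 1 0 y k y21; rewrite addr0 mul1r mul0r addr0 => ->; last by ring.
by rewrite mul0r addr0 mul1r -exprM mulnC exprM expr2 y21 expr1n.
Qed.

(** For these initial values the invariant is 2 (1 - a), so [cheb_bound] can be divided by 1 - a.
    With 1 + a = 2 y^2 this is |T_(2k+1)(y)| <= 1. *)
Lemma cheb_odd_le2 (R : realFieldType) (a : R) k :
  a <= 1 -> (1 + a) * cheb a 1 (2 * a - 1) k ^+ 2 <= 2.
Proof.
rewrite le_eqVlt => /orP[/eqP->|a1].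
  have := @cheb_closed R 1 1 1 0 1 k (mulr1 1).
  rewrite addr0 mul1r mul0r addr0 (_ : 2 * 1 - 1 = 1 :> R); last by ring.
  by move=> ->; rewrite ?mul0r ?expr1n; lra.
have a10 : 0 < 1 - a by lra.
rewrite -(ler_pM2l a10).
have := cheb_bound a 1 (2 * a - 1) k; nra.
Qed.

(* The coefficients 2^n / n! do not increase from n = 1 on, so multiplying a
   partial sum of the exponential series by 1 - s leaves at most 1 + s. *)
Lemma expR_le_homographic (R : realType) (s : R) :
  0 <= s -> s < 1 -> expR (2 * s) <= (1 + s) / (1 - s).
Proof.
move=> s0 s1; have s10 : 0 < 1 - s by lra.
apply: limr_le; first exact: is_cvg_series_exp_coeff.
apply: nearW => n; rewrite ler_pdivlMr //.
(* The negative correction term is what makes the claim inductive; monotone partial sums then cover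
   every n, small ones included. *)
suff H m : series (exp_coeff (2 * s)) m.+2 * (1 - s) <=
    1 + s - s * exp_coeff (2 * s) m.+1.
  have c0 m : 0 <= exp_coeff (2 * s) m.
    by rewrite exp_coeff_ge0 // mulr_ge0.
  have S_ge m : series (exp_coeff (2 * s)) m <= series (exp_coeff (2 * s)) m.+1.
    by rewrite seriesEnat /= big_nat_recr //= lerDl.
  have step m : series (exp_coeff (2 * s)) m * (1 - s) <=
     series (exp_coeff (2 * s)) m.+1 * (1 - s) by rewrite ler_pM2r.
  have := H n; have := step n; have := step n.+1; have := c0 n.+1; nra.
elim: m => [|m IH].
  rewrite seriesEnat /= !big_nat_recr //= big_nil /exp_coeff /= !fact0 factS fact0.
  rewrite !expr0 !expr1 !divr1; nra.
rewrite seriesEnat /= big_nat_recr //= -[X in X + _]/(series (exp_coeff (2 * s)) m.+2).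
have cE : exp_coeff (2 * s) m.+2 = 2 / m.+2%:R * s * exp_coeff (2 * s) m.+1.
  rewrite /exp_coeff /= exprS factS natrM invfM; ring.
have c0 : 0 <= exp_coeff (2 * s) m.+1 by rewrite exp_coeff_ge0 // mulr_ge0.
have : 2 / m.+2%:R <= 1 :> R by rewrite ler_pdivrMr ?ltr0n // mul1r ler_nat.
move: IH; rewrite cE; move: (series _ _) (exp_coeff _ _) c0 => S c c0 IH.
move: (2 / _) => e e1.
have : e * (s * c) <= 1 * (s * c) by rewrite ler_wpM2r // mulr_ge0.
nra.
Qed.

(** * Extremal polynomials for the two rates *)

Lemma poly_1subX (R : idomainType) (P : {poly R}) t :
  P.[0] = 1 -> (size P <= t.+1)%N ->
  exists2 q : {poly R}, (size q <= t)%N & P = 1 - 'X * q.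
Proof.
move=> P0 sP.
have /factor_theorem[q qE] : root (1 - P) 0 by rewrite rootE !hornerE P0 subrr.
rewrite subr0 in qE; exists q; last by rewrite mulrC -qE opprB addrCA subrr addr0.
have [->|q0] := eqVneq q 0; first by rewrite size_poly0.
rewrite -ltnS -(size_mulX q0) -qE.
rewrite (leq_trans (size_polyD _ _)) // geq_max size_polyN sP andbT.
by rewrite size_poly1.
Qed.

(** The residual 1 - X q is T_t(Y) / T_t(y0), where the affine Y maps [m, M] onto [-1, 1] and 0 to
    y0. The numerator is at most 1 in absolute value, and T_t(y0) is at least half of r^t, with r >=
    exp (2 s). *)
Lemma cg_poly (R : realType) (m M : R) (t : nat) :
  0 < m -> m <= M -> (0 < t)%N ->
  exists2 q : {poly R}, (size q <= t)%N &
    forall x, m <= x <= M ->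
      `|1 - x * q.[x]| <= 2 * expR (- 2 * t%:R * Num.sqrt (m / M)).
Proof.
move=> m0 mM t0; have M0 : 0 < M by lra.
have [<-{mM M0}|mM'] := eqVneq m M.
  exists (m^-1)%:P; first by rewrite (leq_trans (size_polyC_leq1 _)).
  move=> x; rewrite -eq_le => /eqP <-; rewrite hornerC divff ?gt_eqF // subrr normr0.
  by rewrite mulr_ge0 // expR_ge0.
have {mM mM'} mM : m < M by rewrite lt_neqAle mM' mM.
have [Mm mMM] : 0 < M - m /\ 0 < M + m by lra.
set s := Num.sqrt (m / M).
have s0 : 0 < s by rewrite sqrtr_gt0 divr_gt0.
have ss : s ^+ 2 = m / M by rewrite sqr_sqrtr // ltW // divr_gt0.
have s1 : s < 1.
  rewrite -(@ltr_pXn2r _ 2) ?nnegrE ?ltW // ss expr1n ltr_pdivrMr ?mul1r //.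
have mE : m = s ^+ 2 * M by rewrite ss mulfVK // gt_eqF.
(* The larger root of z^2 - 2 y0 z + 1, since y0 = (1 + s^2) / (1 - s^2). *)
pose r := (1 + s) / (1 - s).
have [s10 s1p] : 0 < 1 - s /\ 0 < 1 + s by lra.
have r0 : 0 < r by rewrite divr_gt0.
pose y0 := (M + m) / (M - m).
have y0E : 2 * y0 = r + r^-1.
  rewrite /y0 mE /r; field; rewrite !gt_eqF //=.
  by rewrite (_ : _ - _ = M - m) // mE; ring.
pose T := cheb y0 1 y0 t.
have TE : T = 2^-1 * r ^+ t + 2^-1 * r^-1 ^+ t.
  rewrite -(cheb_closed _ _ _ _ y0E) ?divff ?gt_eqF // /T; congr cheb; first by field.
  by rewrite -mulrDr -y0E mulKf ?pnatr_eq0.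
have T_ge : r ^+ t <= 2 * T.
  by rewrite TE mulrDr !mulVKf ?pnatr_eq0 // lerDl exprn_ge0 // invr_ge0 ltW.
have rt0 : 0 < r ^+ t by rewrite exprn_gt0.
have T0 : 0 < T by lra.
pose Y : {poly R} := y0%:P - (2 / (M - m)) *: 'X.
have YE x : Y.[x] = y0 - 2 / (M - m) * x by rewrite /Y !hornerE.
have sY : (size Y <= 2)%N.
  rewrite (leq_trans (size_polyD _ _)) // geq_max size_polyN.
  rewrite (leq_trans (size_polyC_leq1 _)) //=.
  by rewrite (leq_trans (size_scale_leq _ _)) // size_polyX.
have [||q sq qE] := @poly_1subX R (T^-1 *: cheb Y 1 Y t) t.
- by rewrite hornerZ cheb_horner YE mulr0 subr0 hornerC mulVf // gt_eqF.
- by rewrite (leq_trans (size_scale_leq _ _)) // size_cheb // size_poly1.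
exists q => // x /andP[mx xM].
have -> : 1 - x * q.[x] = (1 - 'X * q).[x] by rewrite !hornerE.
rewrite -qE hornerZ cheb_horner hornerC normrM gtr0_norm ?invr_gt0 //.
rewrite mulrC ler_pdivrMr // (le_trans (cheb_le1 _ _)) //.
  rewrite YE /y0 mulrAC -mulrBl.
  rewrite ler_pdivlMr // ler_pdivrMr //; lra.
rewrite mulrAC.
have -> : - 2 * t%:R * s = - (2 * s * t%:R) by ring.
rewrite expRN expRM_natr ler_pdivlMr ?exprn_gt0 ?expR_gt0 // mul1r.
apply: le_trans T_ge; rewrite ler_pXn2r ?nnegrE ?expR_ge0 ?(ltW r0) //.
exact: expR_le_homographic (ltW s0) s1.
Qed.

(* p(z) = T_(2k+1)(y) / y with y^2 = (z - s^2) / (1 - s^2); at z = 0 this is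
   the value of the polynomial at an imaginary point y. *)
Lemma lanczos_poly (R : realType) (s : R) (k : nat) :
  0 < s -> s < 1 ->
  exists p : {poly R}, [/\ (size p <= k.+1)%N,
    (forall z, z <= 1 -> (z - s ^+ 2) * p.[z] ^+ 2 <= 1 - s ^+ 2) &
    (1 - s ^+ 2) * (expR (2 * s * (2 * k + 1)%:R) - 2) <= 4 * s ^+ 2 * p.[0] ^+ 2].
Proof.
move=> s0 s1; have [s10 s1p] : 0 < 1 - s /\ 0 < 1 + s by lra.
have s20 : 0 < 1 - s ^+ 2 by nra.
pose Y : {poly R} := (2 / (1 - s ^+ 2)) *: ('X - (s ^+ 2)%:P) - 1.
have YE x : Y.[x] = 2 * (x - s ^+ 2) / (1 - s ^+ 2) - 1.
  by rewrite /Y !hornerE mulrAC.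
have C1E x : (2 * Y - 1).[x] = 2 * Y.[x] - 1 by rewrite -polyC_natr !hornerE.
have sY : (size Y <= 2)%N.
  rewrite (leq_trans (size_polyD _ _)) // geq_max size_polyN size_poly1 andbT.
  by rewrite (leq_trans (size_scale_leq _ _)) // size_XsubC.
exists (cheb Y 1 (2 * Y - 1) k); split.
- rewrite size_cheb // ?size_poly1 //.
  rewrite (leq_trans (size_polyD _ _)) // geq_max size_polyN size_poly1 andbT.
  by rewrite -polyC_natr mul_polyC (leq_trans (size_scale_leq _ _)).
- move=> z z1; rewrite cheb_horner hornerC C1E.
  have a1 : Y.[z] <= 1.
    by rewrite YE lerBlDr ler_pdivrMr //; lra.
  have := cheb_odd_le2 k a1; rewrite {1}YE.
  rewrite (_ : 1 + (_ - 1) = 2 * (z - s ^+ 2) / (1 - s ^+ 2)); last by ring.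
  rewrite mulrAC ler_pdivrMr //; nra.
rewrite cheb_horner hornerC C1E.
pose Q := (1 + s) / (1 - s).
have Q0 : 0 < Q by rewrite divr_gt0.
have QE : Q - 1 = 2 * s / (1 - s) by rewrite /Q; field; rewrite gt_eqF.
have Q10 : 0 < Q - 1 by rewrite QE divr_gt0 // mulr_gt0.
(* At z = 0 the characteristic roots are -Q and -1/Q; the coefficients in the closed form are fitted
   to the two initial values. *)
have aE : 2 * Y.[0] = - Q + - Q^-1.
  by rewrite YE /Q; field; rewrite !gt_eqF.
have -> : cheb Y.[0] 1 (2 * Y.[0] - 1) k =
   Q / (Q - 1) * (- Q) ^+ k + - (Q - 1)^-1 * (- Q^-1) ^+ k.
  rewrite -(cheb_closed _ _ _ _ aE) ?mulrNN ?divff ?gt_eqF // aE; congr cheb.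
    by field; rewrite gt_eqF.
  by field; rewrite !gt_eqF.
rewrite [(- Q) ^+ k]exprNn [(- Q^-1) ^+ k]exprNn exprVn.
set g := (-1) ^+ k; set u := Q ^+ k.
have u0 : 0 < u by rewrite exprn_gt0.
have gg : g ^+ 2 = 1 by rewrite sqrr_sign.
have -> : Q / (Q - 1) * (g * u) + - (Q - 1)^-1 * (g * u^-1) =
   g * ((Q * u ^+ 2 - 1) / (u * (Q - 1))).
  by field; rewrite !gt_eqF.
rewrite exprMn gg mul1r.
have -> : 4 * s ^+ 2 * ((Q * u ^+ 2 - 1) / (u * (Q - 1))) ^+ 2 =
  (1 - s ^+ 2) * ((Q * u ^+ 2 - 1) ^+ 2 / (Q * u ^+ 2)).
  rewrite QE /Q; field.
  by rewrite !gt_eqF //=.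
rewrite ler_pM2l //.
set X := Q * u ^+ 2.
have XE : X = Q ^+ (2 * k + 1).
  by rewrite /X /u -exprM mulnC addn1 exprS.
have X0 : 0 < X by rewrite XE exprn_gt0.
have -> : (X - 1) ^+ 2 / X = X - 2 + X^-1 by field; rewrite gt_eqF.
have : 0 <= X^-1 by rewrite invr_ge0 ltW.
suff : expR (2 * s * (2 * k + 1)%:R) <= X by lra.
rewrite XE expRM_natr ler_pXn2r ?nnegrE ?expR_ge0 ?(ltW Q0) ?addn1 //.
exact: expR_le_homographic (ltW s0) s1.
Qed.

(** * Euclidean geometry and polynomials of a matrix *)

Section Dot.
Variables (R : realType) (d : nat).
Implicit Types (x y z : 'cV[R]_d) (a : R) (A : 'M[R]_d).

Lemma dotE x y : dot x y = \sum_i x i 0 * y i 0.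
Proof. by rewrite /dot mxE; apply: eq_bigr => i _; rewrite mxE. Qed.

Lemma dotC x y : dot x y = dot y x.
Proof. by rewrite !dotE; apply: eq_bigr => i _; rewrite mulrC. Qed.

Lemma dotDr x y z : dot x (y + z) = dot x y + dot x z.
Proof. by rewrite /dot mulmxDr mxE. Qed.

Lemma dotDl x y z : dot (y + z) x = dot y x + dot z x.
Proof. by rewrite dotC dotDr !(dotC x). Qed.

Lemma dotZr a x y : dot x (a *: y) = a * dot x y.
Proof. by rewrite /dot -scalemxAr mxE. Qed.

Lemma dotZl a x y : dot (a *: x) y = a * dot x y.
Proof. by rewrite dotC dotZr dotC. Qed.

Lemma dotNr x y : dot x (- y) = - dot x y.
Proof. by rewrite -scaleN1r dotZr mulN1r. Qed.

Lemma dotNl x y : dot (- x) y = - dot x y.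
Proof. by rewrite dotC dotNr dotC. Qed.

Lemma dot0r x : dot x 0 = 0.
Proof. by rewrite -(scale0r 0) dotZr mul0r. Qed.

Lemma dot0l x : dot 0 x = 0.
Proof. by rewrite dotC dot0r. Qed.

Definition dot_lin := (dotDl, dotDr, dotZl, dotZr, dotNl, dotNr, dot0l, dot0r).

Lemma dot_ge0 x : 0 <= dot x x.
Proof. by rewrite dotE; apply: sumr_ge0 => i _; rewrite -expr2 sqr_ge0. Qed.

Lemma dot_eq0 x : (dot x x == 0) = (x == 0).
Proof.
apply/eqP/eqP=> [|->]; last exact: dot0l.
rewrite dotE => /eqP; rewrite psumr_eq0; last by move=> i _; rewrite -expr2 sqr_ge0.
move=> /allP x0; apply/colP=> i; rewrite mxE.
by have /eqP := x0 i (mem_index_enum i); rewrite -expr2 => /eqP; rewrite sqrf_eq0 => /eqP.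
Qed.

Lemma dot_gt0 x : (0 < dot x x) = (x != 0).
Proof. by rewrite lt_def dot_eq0 dot_ge0 andbT. Qed.

Lemma cauchy_schwarz x y : dot x y ^+ 2 <= dot x x * dot y y.
Proof.
have [->|y0] := eqVneq y 0; first by rewrite !dot0r mulr0 expr0n.
have y1 : 0 < dot y y by rewrite dot_gt0.
have := dot_ge0 (dot y y *: x - dot x y *: y).
rewrite !dot_lin (dotC y x) => H.
rewrite -subr_ge0 -(pmulr_rge0 _ y1).
by apply: le_trans H _; rewrite le_eqVlt; apply/orP; left; apply/eqP; ring.
Qed.

Lemma enorm_ge0 x : 0 <= enorm x.
Proof. exact: sqrtr_ge0. Qed.

Lemma enorm_sqr x : enorm x ^+ 2 = dot x x.
Proof. by rewrite sqr_sqrtr // dot_ge0. Qed.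

Lemma enorm_le x a : 0 <= a -> (enorm x <= a) = (dot x x <= a ^+ 2).
Proof. by move=> a0; rewrite -enorm_sqr ler_pXn2r ?nnegrE ?enorm_ge0. Qed.

Lemma dot_symm A x y : A^T = A -> dot (A *m x) y = dot x (A *m y).
Proof. by move=> symA; rewrite /dot trmx_mul symA mulmxA. Qed.

Lemma qobjD A (b x h : 'cV[R]_d) : A^T = A ->
  qobj A b (x + h) = qobj A b x + dot (A *m x + b) h + 2^-1 * dot h (A *m h).
Proof.
move=> symA; rewrite /qobj mulmxDr !dot_lin -!(dot_symm _ _ symA).
rewrite (dotC (A *m h) x) -(dot_symm _ _ symA); by field.
Qed.

End Dot.

Section PolynomialOfMatrix.
Variables (R : realType) (d : nat) (A : 'M[R]_d.+1).
Hypothesis symA : A^T = A.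
Implicit Types (x y : 'cV[R]_d.+1) (p q : {poly R}).

Lemma tr_horner_mx p : (horner_mx A p)^T = horner_mx A p.
Proof.
elim/poly_ind: p => [|p c IH]; first by rewrite rmorph0 trmx0.
rewrite rmorphD rmorphM /= horner_mx_X horner_mx_C linearD /= tr_scalar_mx.
rewrite trmx_mul IH symA; congr (_ + _).
exact: (comm_mx_horner p (comm_mx_refl A)).
Qed.

Lemma dot_horner_mx p q x y :
  dot (horner_mx A p *m x) (horner_mx A q *m y) = dot x (horner_mx A (p * q) *m y).
Proof. by rewrite dot_symm ?tr_horner_mx // mulmxA rmorphM. Qed.

(** Reduces comparisons of quadratic forms to scalar inequalities on the spectrum. *)
Lemma horner_mx_form_le p q x :
  (forall a, eigenvalue A a -> p.[a] <= q.[a]) ->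
  dot x (horner_mx A p *m x) <= dot x (horner_mx A q *m x).
Proof.
move=> pq; rewrite -subr_ge0 -dotNr -dotDr -mulmxBl -rmorphB.
by apply: horner_mx_psd => // a /pq; rewrite !hornerE subr_ge0.
Qed.

Lemma horner_mxC_mul c x : horner_mx A c%:P *m x = c *: x.
Proof. by rewrite horner_mx_C mul_scalar_mx. Qed.

Lemma horner_mxZ_mul c p x : horner_mx A (c *: p) *m x = c *: (horner_mx A p *m x).
Proof. by rewrite horner_mxZ -scalemxAl. Qed.

Lemma horner_mxD_mul p q x :
  horner_mx A (p + q) *m x = horner_mx A p *m x + horner_mx A q *m x.
Proof. by rewrite rmorphD mulmxDl. Qed.

Lemma horner_mxM_mul p q x :
  horner_mx A (p * q) *m x = horner_mx A p *m (horner_mx A q *m x).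
Proof. by rewrite rmorphM mulmxA. Qed.

End PolynomialOfMatrix.

Lemma horner_mx_mem_krylov (R : realType) (d : nat) (A : 'M[R]_d.+1)
    (b : 'cV[R]_d.+1) (p : {poly R}) (t : nat) :
  (size p <= t)%N -> horner_mx A p *m b \in krylov A b t.
Proof.
move=> sp; rewrite -[p]coefK poly_def rmorph_sum mulmx_suml.
apply: memv_suml => i _; rewrite -mul_polyC rmorphM /= -mulmxA horner_mxC_mul memvZ //.
rewrite rmorphXn /= horner_mx_X; apply: memv_span.
by apply/mapP; exists (i : nat); rewrite // mem_iota (leq_trans (ltn_ord i)).
Qed.

(** * The linear rate *)

(** x is a critical point of the objective with A shifted by lam, whose gap is purely quadratic;
    undoing the shift gives the last term, which vanishes when x and y have equal norms. *)
Lemma qobj_gap (R : realType) (d : nat) (A : 'M[R]_d) (b x y : 'cV[R]_d) lam :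
  A^T = A -> (A + lam%:M) *m x = - b ->
  qobj A b y - qobj A b x =
    2^-1 * dot (y - x) ((A + lam%:M) *m (y - x))
    + lam / 2 * (dot x x - dot y y).
Proof.
move=> symA xE; have [h ->] : exists h, y = x + h by exists (y - x); rewrite addrC subrK.
have -> : b = - (A *m x + lam *: x) by rewrite -mul_scalar_mx -mulmxDl xE opprK.
rewrite qobjD // (addrC x h) addrK mulmxDl mul_scalar_mx !dot_lin (dotC h x).
by field.
Qed.

(** |X v - Z| <= 2 de X, while Z >= (1 - de) X >= 2/3 X, so the relative error is at most 3 de. *)
Lemma scaled_error (R : realFieldType) (X Z de v : R) :
  0 < X -> 0 <= Z -> 0 <= de -> de <= 3^-1 ->
  ((1 - de) * X) ^+ 2 <= Z ^+ 2 -> Z ^+ 2 <= ((1 + de) * X) ^+ 2 ->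
  `|1 - v| <= de -> (X / Z * v - 1) ^+ 2 <= 9 * de ^+ 2.
Proof.
move=> X0 Z0 de0 de3 ZX XZ; rewrite ler_norml => /andP[v1 v2].
have Z1 : (1 - de) * X <= Z.
  by move: ZX; rewrite ler_pXn2r // nnegrE mulr_ge0 //; lra.
have Z2 : Z <= (1 + de) * X.
  by move: XZ; rewrite ler_pXn2r // nnegrE mulr_ge0 //; lra.
have Zp : 0 < Z by nra.
rewrite (_ : _ - 1 = (X * v - Z) / Z); last by field; rewrite gt_eqF.
rewrite exprMn exprVn ler_pdivrMr ?exprn_gt0 //.
have -> : 9 * de ^+ 2 * Z ^+ 2 = (3 * de * Z) ^+ 2 by ring.
have B1 : X * v - Z <= 3 * de * Z by nra.
have B2 : - (X * v - Z) <= 3 * de * Z by nra.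
have : 0 <= 3 * de * Z by rewrite !mulr_ge0.
nra.
Qed.

Lemma linear_rate_bound (R : realType) (d : nat) (A : 'M[R]_d.+1)
    (b xstar s : 'cV[R]_d.+1) (rad lmin lmax lam : R) (t : nat) :
  A^T = A -> (forall a, eigenvalue A a -> lmin <= a <= lmax) -> lmin <= lmax ->
  enorm xstar <= rad -> (A + lam%:M) *m xstar = - b ->
  0 <= lmin + lam -> 0 <= lam -> (0 < t)%N ->
  (forall y, y \in krylov A b t /\ enorm y <= rad -> qobj A b s <= qobj A b y) ->
  qobj A b s - qobj A b xstar <=
    36 * (qobj A b 0 - qobj A b xstar) * linear_rate lmin lmax lam t.
Proof.
move=> symA eigA lmM xr xE m0 lam0 t0 smin.
have gap := qobj_gap _ symA xE.
have rad0 : 0 <= rad := le_trans (enorm_ge0 _) xr.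
pose l : {poly R} := 'X + lam%:P.
have lE : A + lam%:M = horner_mx A l by rewrite rmorphD /= horner_mx_X horner_mx_C.
have form_ge0 y : 0 <= dot y ((A + lam%:M) *m y).
  by rewrite lE horner_mx_psd // => a /eigA/andP[? ?]; rewrite !hornerE; lra.
have gap0 : qobj A b 0 - qobj A b xstar =
    2^-1 * dot xstar ((A + lam%:M) *m xstar) + lam / 2 * dot xstar xstar.
  by rewrite gap sub0r mulmxN !dot_lin opprK subr0.
have gap0_ge0 : 0 <= qobj A b 0 - qobj A b xstar.
  by rewrite gap0 addr_ge0 // !mulr_ge0 ?invr_ge0 ?dot_ge0 ?form_ge0.
have s_le0 : qobj A b s <= qobj A b 0.
  by apply: smin; rewrite mem0v enorm_le // dot0r sqr_ge0.
set de := 2 * expR (- 2 * t%:R * Num.sqrt ((lmin + lam) / (lmax + lam))).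
have -> : 36 * (qobj A b 0 - qobj A b xstar) * linear_rate lmin lmax lam t =
    9 * de ^+ 2 * (qobj A b 0 - qobj A b xstar).
  rewrite /linear_rate /de exprMn -expRM_natr.
  set e1 := expR _; set e2 := expR _.
  have -> : e1 = e2 by congr expR; ring.
  by ring.
have de0 : 0 <= de by rewrite mulr_ge0 // expR_ge0.
(* If de > 1/3 then 9 de^2 > 1, and comparing with the feasible point 0 suffices. *)
have [de3|de3] := leP de 3^-1; last first.
  apply: (@le_trans _ _ (1 * (qobj A b 0 - qobj A b xstar))).
    by rewrite mul1r lerD2r.
  by rewrite ler_wpM2r //; nra.
have [x0|x0] := eqVneq xstar 0.
  by rewrite x0 subrr mulr0 subr_le0.
have X0 : 0 < enorm xstar by rewrite sqrtr_gt0 dot_gt0.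
(* A vanishing lmin + lam would give de = 2. *)
have mp : 0 < lmin + lam.
  rewrite lt_def m0 andbT; apply/eqP => m00; move: de3.
  by rewrite /de m00 mul0r sqrtr0 mulr0 expR0; lra.
have mM : lmin + lam <= lmax + lam by rewrite lerD2r.
have [q sq qP] := cg_poly mp mM t0.
pose q' := q \Po l.
have sl : size l = 2 by rewrite size_XaddC.
have sq' : (size q' <= t)%N by rewrite size_comp_poly2.
pose w := q' * l.
have wP a : eigenvalue A a -> `|1 - w.[a]| <= de.
  move=> /eigA/andP[a1 a2].
  rewrite hornerM horner_comp !hornerE mulrC.
  by apply: qP; rewrite !lerD2r a1 a2.
pose z := horner_mx A w *m xstar.
have zE : z = horner_mx A (- q') *m b.
  by rewrite /z rmorphM rmorphN /= -mulmxA -lE xE mulmxN mulNmx.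
pose c := enorm xstar / enorm z.
have zz : dot z z = dot xstar (horner_mx A (w ^+ 2) *m xstar).
  by rewrite /z dot_horner_mx // expr2.
have wP1 a : eigenvalue A a -> (1 - de) ^+ 2 <= w.[a] ^+ 2 <= (1 + de) ^+ 2.
  by move=> /wP; rewrite ler_norml => /andP[? ?]; apply/andP; split; nra.
have z1 : ((1 - de) * enorm xstar) ^+ 2 <= enorm z ^+ 2.
  rewrite exprMn !enorm_sqr zz -dotZr -(horner_mxC_mul A).
  apply: horner_mx_form_le => // a /wP1/andP[H _].
  by rewrite hornerC horner_exp.
have z2 : enorm z ^+ 2 <= ((1 + de) * enorm xstar) ^+ 2.
  rewrite exprMn !enorm_sqr zz -dotZr -(horner_mxC_mul A).
  apply: horner_mx_form_le => // a /wP1/andP[_ H].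
  by rewrite hornerC horner_exp.
have zn0 : enorm z != 0.
  apply/eqP=> ez; move: z1; rewrite ez expr0n /= leNgt exprn_gt0 // mulr_gt0 //; lra.
have cz : dot (c *: z) (c *: z) = dot xstar xstar.
  rewrite !dot_lin -!enorm_sqr /c; by field.
apply: (@le_trans _ _ (qobj A b (c *: z) - qobj A b xstar)).
  rewrite lerD2r; apply: smin; split.
    by rewrite memvZ // zE horner_mx_mem_krylov // size_polyN.
  by rewrite enorm_le // cz -enorm_le.
rewrite gap cz subrr mulr0 addr0 gap0.
apply: (@le_trans _ _ (9 * de ^+ 2 * (2^-1 * dot xstar ((A + lam%:M) *m xstar)))); last first.
  apply: ler_wpM2l; first by rewrite mulr_ge0 ?sqr_ge0.
  by rewrite lerDl !mulr_ge0 ?invr_ge0 ?dot_ge0.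
rewrite mulrCA ler_pM2l ?invr_gt0 //.
(* Both sides become forms of polynomials in A at [xstar], to be compared at each eigenvalue a: (c
   w(a) - 1)^2 (a + lam) against 9 de^2 (a + lam). *)
have -> : c *: z - xstar = horner_mx A (c%:P * w - 1) *m xstar.
  by rewrite rmorphB rmorphM rmorph1 /= mulmxBl mul1mx -mulmxA horner_mxC_mul.
rewrite lE mulmxA -[_ *m horner_mx A _]rmorphM dot_horner_mx //.
rewrite -dotZr -(horner_mxC_mul A) mulmxA -[_ *m horner_mx A _]rmorphM.
apply: horner_mx_form_le => // a ea.
have := wP a ea; have /andP[a1 a2] := eigA a ea.
have -> : ((c%:P * w - 1) * (l * (c%:P * w - 1))).[a] = (c * w.[a] - 1) ^+ 2 * (a + lam).
  by rewrite !(hornerM, hornerD, hornerN, hornerC, hornerX); ring.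
have -> : ((9 * de ^+ 2)%:P * l).[a] = 9 * de ^+ 2 * (a + lam).
  by rewrite !(hornerM, hornerD, hornerC, hornerX).
move=> wa; rewrite ler_wpM2r //; first by lra.
exact: scaled_error X0 (enorm_ge0 z) de0 de3 z1 z2 wa.
Qed.

(** * Accelerated proximal gradient steps in a ball *)

(** The projection enters through its variational inequality. Outside the ball, c = rad / |w| and
    the inequality is Cauchy-Schwarz. *)
Lemma ball_projection (R : realType) (d : nat) (rad : R) (w : 'cV[R]_d) :
  0 < rad ->
  exists c : R, dot (c *: w) (c *: w) <= rad ^+ 2 /\
    forall x, dot x x <= rad ^+ 2 -> dot (w - c *: w) (x - c *: w) <= 0.
Proof.
move=> rad0; have [wr|wr] := leP (dot w w) (rad ^+ 2).
  by exists 1; rewrite scale1r; split=> // x _; rewrite subrr dot0l.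
have n0 : rad < enorm w.
  by rewrite -(@ltr_pXn2r _ 2) ?nnegrE ?enorm_ge0 ?(ltW rad0) // enorm_sqr.
have n1 : 0 < enorm w by apply: lt_trans n0.
exists (rad / enorm w); split.
  rewrite dotZl dotZr -enorm_sqr le_eqVlt; apply/orP; left; apply/eqP.
  by field; rewrite gt_eqF.
move=> x xr; set c := rad / enorm w.
have c1 : 0 <= 1 - c by rewrite subr_ge0 ler_pdivrMr // mul1r ltW.
rewrite -{1}[w]scale1r -scalerBl dotZl mulr_ge0_le0 // dotDr dotNr dotZr subr_le0.
have -> : c * dot w w = rad * enorm w by rewrite -enorm_sqr /c; field; rewrite gt_eqF.
have [|wx] := leP (dot w x) 0.
  by move/le_trans; apply; rewrite mulr_ge0 // ltW.
rewrite -(@ler_pXn2r _ 2) ?nnegrE ?(ltW wx) // ?mulr_ge0 ?(ltW rad0) ?(ltW n1) //.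
apply: le_trans (cauchy_schwarz _ _) _.
by rewrite exprMn enorm_sqr mulrC ler_wpM2r // dot_ge0.
Qed.

Lemma dot_convex (R : realType) (d : nat) (x y : 'cV[R]_d) (th : R) :
  0 <= th <= 1 ->
  dot ((1 - th) *: x + th *: y) ((1 - th) *: x + th *: y) <=
    (1 - th) * dot x x + th * dot y y.
Proof.
move=> /andP[th0 th1].
have : 0 <= th * (1 - th) * dot (x - y) (x - y).
  by rewrite !mulr_ge0 ?dot_ge0 // subr_ge0.
rewrite !dot_lin (dotC y x); lra.
Qed.

Section Accelerated.
Variables (R : realType) (d : nat) (G : 'M[R]_d) (b : 'cV[R]_d) (L mu rad : R).
Hypotheses (symG : G^T = G) (L0 : 0 < L) (mu0 : 0 <= mu) (rad0 : 0 < rad).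
Hypotheses (G_ge0 : forall x, 0 <= dot x (G *m x)).
Hypotheses (G_leL : forall x, dot x (G *m x) <= L * dot x x).

Let F x := qobj G b x + mu / 2 * dot x x.

(** v' minimises <g, w> + th L / 2 |w - v|^2 + mu / 2 |w|^2 over w in the ball, g being the gradient
    at y. The estimate adds smoothness at y, convexity towards x and u with weights 1 - th and th,
    and optimality of v'. *)
Lemma accelerated_step (th : R) (x v : 'cV[R]_d) :
  0 < th <= 1 -> dot x x <= rad ^+ 2 -> dot v v <= rad ^+ 2 ->
  let y := (1 - th) *: x + th *: v in
  exists c : R, let v' := c *: (th * L *: v - (G *m y + b)) in
    let x' := (1 - th) *: x + th *: v' in
    [/\ dot v' v' <= rad ^+ 2, dot x' x' <= rad ^+ 2 &
     forall u, dot u u <= rad ^+ 2 ->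
       F x' - F u <= (1 - th) * (F x - F u) +
         th ^+ 2 * L / 2 * (dot (u - v) (u - v) - dot (u - v') (u - v'))].
Proof.
move=> /andP[th0 th1] xr vr y; have yE : y = (1 - th) *: x + th *: v := erefl.
clearbody y; set g := G *m y + b; have gE : g = G *m y + b := erefl.
(* The Hessian of the proximal problem is si times the identity, so its solution is the projection
   of the unconstrained minimiser. *)
pose si := th * L + mu.
have si0 : 0 < si by rewrite ltr_wpDr // mulr_gt0.
have [c [v'r proj]] := ball_projection (si^-1 *: (th * L *: v - g)) rad0.
exists (c * si^-1); rewrite -scalerA; set v' := c *: (si^-1 *: _) in v'r proj *.
cbv zeta; set x' := _ + th *: v'; have x'_def : x' = (1 - th) *: x + th *: v' := erefl.
clearbody g v' x'; have th01 : 0 <= th <= 1 by rewrite (ltW th0).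
have x'r : dot x' x' <= rad ^+ 2.
  rewrite x'_def; apply: le_trans (dot_convex x v' th01) _.
  have : 0 <= 1 - th by rewrite subr_ge0.
  nra.
split=> // u ur.
have opt : dot (th * L *: v - g - si *: v') (u - v') <= 0.
  have := proj u ur; rewrite -(pmulr_rle0 _ si0) -dotZl scalerBr scalerA.
  by rewrite mulfV ?scale1r // gt_eqF.
have x'E : x' = y + th *: (v' - v).
  by rewrite x'_def yE scalerBr [_ *: v' - _]addrC addrA addrK.
have smooth := G_leL (th *: (v' - v)).
have hx' : qobj G b x' <= qobj G b y + th * dot g (v' - v)
    + th ^+ 2 * L / 2 * dot (v' - v) (v' - v).
  rewrite x'E qobjD // -gE dotZr -[in leRHS]addrA -[in leLHS]addrA !lerD2l.
  by move: smooth; rewrite [in X in _ <= X]dotZl [in X in _ <= X]dotZr; lra.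
have convex z : qobj G b y + dot g (z - y) <= qobj G b z.
  have {2}-> : z = y + (z - y) by rewrite addrC subrK.
  by rewrite qobjD // -gE lerDl mulr_ge0 ?invr_ge0.
have hx := convex x; have hu := convex u.
have hn := dot_convex x v' th01; rewrite -x'_def in hn.
have {}hn : mu / 2 * dot x' x' <= mu / 2 * ((1 - th) * dot x x + th * dot v' v').
  by rewrite ler_wpM2l // divr_ge0.
have {}hx : (1 - th) * (qobj G b y + dot g (x - y)) <= (1 - th) * qobj G b x.
  by rewrite ler_wpM2l // subr_ge0.
have {}hu : th * (qobj G b y + dot g (u - y)) <= th * qobj G b u.
  by rewrite ler_wpM2l // ltW.
have {}opt : th * dot (th * L *: v - g - si *: v') (u - v') <= 0.
  by rewrite pmulr_rle0.
(* The strong convexity gain of the proximal problem is discarded. *)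
have young : 0 <= th * mu / 2 * dot (u - v') (u - v').
  by rewrite !mulr_ge0 ?dot_ge0 ?(ltW th0) ?invr_ge0.
move: hx' hx hu hn opt young; rewrite /F /si [in dot g (x - y)]yE [in dot g (u - y)]yE.
rewrite !dot_lin (dotC v u) (dotC v' u) (dotC v' v); lra.
Qed.

End Accelerated.

(* With th = 2 / (t + 2) one has (1 - th) / th^2 = t (t + 2) / 4 and
   1 / th^2 >= (t + 1) (t + 3) / 4, so the accelerated steps carry the
   induction on t (t + 2) (F x - F u) + 2 L |u - v|^2 <= 2 L |u|^2. *)
Lemma accelerated_bound (R : realType) (d : nat) (G : 'M[R]_d.+1)
    (b u : 'cV[R]_d.+1) (L mu rad : R) (t : nat)
    (F := fun x => qobj G b x + mu / 2 * dot x x) :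
  G^T = G -> 0 < L -> 0 <= mu -> 0 < rad ->
  (forall x, 0 <= dot x (G *m x)) -> (forall x, dot x (G *m x) <= L * dot x x) ->
  dot u u <= rad ^+ 2 -> (forall x, dot x x <= rad ^+ 2 -> F u <= F x) ->
  exists p : {poly R}, let x := horner_mx G p *m b in
    [/\ (size p <= t)%N, dot x x <= rad ^+ 2 &
        t%:R * (t%:R + 2) * (F x - F u) <= 2 * L * dot u u].
Proof.
move=> symG L0 mu0 rad0 G_ge0 G_leL ur umin.
suff [p [q [sp sq pr qr H]]] : exists p q : {poly R},
   let x := horner_mx G p *m b in let v := horner_mx G q *m b in
   [/\ (size p <= t)%N, (size q <= t)%N, dot x x <= rad ^+ 2, dot v v <= rad ^+ 2 &
   t%:R * (t%:R + 2) * (F x - F u) <= 2 * L * (dot u u - dot (u - v) (u - v))].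
  exists p; split=> //; apply: le_trans H _.
  by rewrite ler_pM2l ?mulr_gt0 // gerDl oppr_le0 dot_ge0.
elim: t => [|t [p [q [/= sp sq xr vr IH]]]].
  exists 0, 0; rewrite /= rmorph0 mul0mx !subr0 dot0r size_poly0 !mul0r subrr mulr0.
  by split=> //; rewrite sqr_ge0.
set x := horner_mx G p *m b in xr IH; set v := horner_mx G q *m b in vr IH.
pose th : R := 2 / (t%:R + 2).
have t20 : 0 < t%:R + 2 :> R by rewrite ltr_wpDl.
have th01 : 0 < th <= 1.
  by rewrite divr_gt0 //= ler_pdivrMr // mul1r lerDr.
have [c [v'r x'r H]] := accelerated_step b symG L0 mu0 rad0 G_ge0 G_leL th01 xr vr.
pose yp := (1 - th) *: p + th *: q.
(* X yp + 1 represents the gradient G y + b, so each step raises the size bound by one. *)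
pose vp := c *: ((th * L) *: q - ('X * yp + 1)).
set v' := c *: _ in v'r x'r H; set x' := _ + th *: v' in x'r H.
have syp : (size yp <= t)%N.
  rewrite (leq_trans (size_polyD _ _)) // geq_max.
  by rewrite !(leq_trans (size_scale_leq _ _)).
have svp : (size vp <= t.+1)%N.
  rewrite (leq_trans (size_scale_leq _ _)) // (leq_trans (size_polyD _ _)) //.
  rewrite geq_max size_polyN (leq_trans (size_scale_leq _ _)) ?(leqW sq) //=.
  rewrite (leq_trans (size_polyD _ _)) // geq_max size_poly1 andbT.
  rewrite (leq_trans (size_polyMleq _ _)) // size_polyX; exact: syp.
have v'E : horner_mx G vp *m b = v'.
  rewrite /vp /yp /v' horner_mxZ_mul horner_mxD_mul horner_mxZ_mul rmorphN mulNmx.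
  rewrite horner_mxD_mul horner_mxM_mul horner_mxD_mul !horner_mxZ_mul.
  by rewrite horner_mx_X rmorph1 mul1mx.
have x'E : horner_mx G ((1 - th) *: p + th *: vp) *m b = x'.
  by rewrite horner_mxD_mul (horner_mxZ_mul _ _ p) (horner_mxZ_mul _ _ vp) v'E.
exists ((1 - th) *: p + th *: vp), vp; rewrite /= x'E v'E; split=> //.
  rewrite (leq_trans (size_polyD _ _)) // geq_max.
  rewrite (leq_trans (size_scale_leq _ p) (leqW sp)).
  exact: leq_trans (size_scale_leq _ vp) svp.
have {}H := H u ur; rewrite -!/(F _) in H.
(* Nonnegativity allows (t + 2)^2 to be lowered to (t + 1) (t + 3). *)
have E0 : 0 <= F x' - F u by rewrite subr_ge0 umin.
have : (t%:R + 2) ^+ 2 * (F x' - F u) <= t%:R * (t%:R + 2) * (F x - F u)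
    + 2 * L * (dot (u - v) (u - v) - dot (u - v') (u - v')).
  have -> : t%:R * (t%:R + 2) * (F x - F u)
    + 2 * L * (dot (u - v) (u - v) - dot (u - v') (u - v')) =
    (t%:R + 2) ^+ 2 * ((1 - th) * (F x - F u) +
      th ^+ 2 * L / 2 * (dot (u - v) (u - v) - dot (u - v') (u - v'))).
    by rewrite /th; field; rewrite gt_eqF.
  by rewrite ler_pM2l // exprn_gt0.
rewrite -natr1; nra.
Qed.

(** * Approximate eigenvectors in the Krylov space *)

Lemma eigenvalue_shift (K : fieldType) (n : nat) (A : 'M[K]_n) (c a : K) :
  eigenvalue (A - c%:M) a -> eigenvalue A (a + c).
Proof.
move=> /eigenvalueP[v vE v0]; apply/eigenvalueP; exists v => //.
by rewrite scalerDl -vE mulmxBr mul_mx_scalar subrK.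
Qed.

Lemma horner_mx_shift (K : comNzRingType) (n : nat) (A : 'M[K]_n.+1) (c : K)
    (p : {poly K}) :
  horner_mx (A - c%:M) p = horner_mx A (p \Po ('X - c%:P)).
Proof.
elim/poly_ind: p => [|p a IH]; first by rewrite comp_poly0 !rmorph0.
rewrite comp_polyD comp_polyM comp_polyC comp_polyX !rmorphD !rmorphM /= IH.
by rewrite !horner_mx_C horner_mx_X rmorphB /= horner_mx_X horner_mx_C.
Qed.

Lemma horner_mx_eigenvector (K : comNzRingType) (n : nat) (A : 'M[K]_n.+1) (a : K)
    (u : 'cV[K]_n.+1) (p : {poly K}) :
  A *m u = a *: u -> horner_mx A p *m u = p.[a] *: u.
Proof.
move=> Au; elim/poly_ind: p => [|p c IH]; first by rewrite rmorph0 mul0mx horner0 scale0r.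
rewrite rmorphD rmorphM /= horner_mx_X horner_mx_C mulmxDl -mulmxA Au -scalemxAr IH.
by rewrite mul_scalar_mx !hornerE scalerDl scalerA mulrC.
Qed.

Lemma sub_half_gt0 (R : realFieldType) (t : nat) : (0 < t)%N -> 0 < t%:R - 2^-1 :> R.
Proof.
move=> t0; have t1 : 1 <= t%:R :> R by rewrite ler1n.
lra.
Qed.

(** The claim is <b, q(G) b> <= 0 for q(a) = (a - L s^2) P(a)^2. Splitting b along u, the orthogonal
    part contributes at most L (1 - s^2) times its squared norm, and the u part is negative enough
    because P(0) is large. *)
Lemma lanczos_bound (R : realType) (d : nat) (G : 'M[R]_d.+1)
    (b u : 'cV[R]_d.+1) (L : R) (t : nat) :
  G^T = G -> 0 < L -> (forall a, eigenvalue G a -> 0 <= a <= L) ->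
  G *m u = 0 -> dot u u = 1 -> dot u b != 0 -> (0 < t)%N ->
  exists p : {poly R}, let z := horner_mx G p *m b in
    [/\ (size p <= t)%N, 0 < dot z z &
        dot z (G *m z) <= L * (ln (4 * dot b b / dot u b ^+ 2) ^+ 2 /
          (16 * (t%:R - 2^-1) ^+ 2)) * dot z z].
Proof.
move=> symG L0 eigG Gu uu ub t0.
have th0 := sub_half_gt0 R t0.
have ub2 : 0 < dot u b ^+ 2 by rewrite exprn_even_gt0.
have ub_le : dot u b ^+ 2 <= dot b b.
  by apply: le_trans (cauchy_schwarz _ _) _; rewrite uu mul1r.
set r := 4 * dot b b / dot u b ^+ 2.
have r4 : 4 <= r by rewrite ler_pdivlMr // ler_pM2l.
have ln0 : 0 < ln r by rewrite ln_gt0 //; lra.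
(* s is chosen so that exp (4 s (t - 1/2)) = r. *)
pose s := ln r / (4 * (t%:R - 2^-1)).
have s0 : 0 < s by rewrite divr_gt0 // mulr_gt0.
have -> : ln r ^+ 2 / (16 * (t%:R - 2^-1) ^+ 2) = s ^+ 2.
  rewrite /s; set h := _ - _ in th0 *.
  by field; rewrite gt_eqF.
have bb0 : 0 < dot b b by apply: lt_le_trans ub_le.
have GX : G = horner_mx G 'X by rewrite horner_mx_X.
(* For s >= 1 the vector b itself works, its Rayleigh quotient being at most L. *)
have [s1|s1] := leP 1 s.
  exists 1; rewrite rmorph1 mul1mx size_poly1; split=> //.
  apply: (@le_trans _ _ (L * dot b b)).
    rewrite {1}GX -dotZr -(horner_mxC_mul G); apply: horner_mx_form_le => // a /eigG/andP[_ ?].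
    by rewrite hornerX hornerC.
  by rewrite -mulrA ler_pM2l // ler_peMl ?(ltW bb0) // expr_ge1 // ltW.
have [p [sp p_le p_ge]] := lanczos_poly t.-1 s0 s1.
rewrite prednK // in sp.
(* Degree t - 1 gives the odd index 2 (t - 1) + 1 = 2 (t - 1/2), the source of the shift by one
   half. *)
have sE : 2 * s * (2 * t.-1 + 1)%:R = ln r.
  have -> : (2 * t.-1 + 1)%:R = 2 * (t%:R - 2^-1) :> R.
    rewrite -{2}(prednK t0) natrD natrM -natr1; by field.
  rewrite /s; set h := _ - _ in th0 *.
  by field; rewrite gt_eqF.
rewrite sE lnK ?posrE ?(lt_le_trans _ r4) // in p_ge.
have s21 : 0 < 1 - s ^+ 2 by nra.
pose P := p \Po (L^-1 *: 'X).
have PE a : P.[a] = p.[a / L] by rewrite horner_comp !hornerE mulrC.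
have P0 : P.[0] = p.[0] by rewrite PE mul0r.
(* The factor 4 in r absorbs the -2 in [p_ge] with room to spare; the strict inequality forces p(0),
   and hence z, to be nonzero. *)
have main : (1 - s ^+ 2) * (dot b b - dot u b ^+ 2) <
    s ^+ 2 * p.[0] ^+ 2 * dot u b ^+ 2.
  have : (1 - s ^+ 2) * (r - 2) * dot u b ^+ 2 <= 4 * s ^+ 2 * p.[0] ^+ 2 * dot u b ^+ 2.
    by rewrite ler_pM2r.
  have -> : (1 - s ^+ 2) * (r - 2) * dot u b ^+ 2 =
      (1 - s ^+ 2) * (4 * dot b b - 2 * dot u b ^+ 2).
    by rewrite /r; field; rewrite ub.
  have := mulr_gt0 s21 ub2; lra.
have p0 : p.[0] != 0.
  apply/eqP => p0; move: main; rewrite p0 expr0n /= mulr0 mul0r ltNge.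
  by rewrite (mulr_ge0 (ltW s21)) // subr_ge0.
have Pu : horner_mx G P *m u = p.[0] *: u.
  by rewrite -P0; apply: horner_mx_eigenvector; rewrite scale0r.
exists P; cbv zeta; set z := horner_mx G P *m b; split.
- by rewrite size_comp_poly2 // size_scale ?size_polyX // invr_eq0 gt_eqF.
- rewrite dot_gt0; apply/eqP => z0; move: ub; rewrite -(mulrI_eq0 _ (mulfI p0)).
  by rewrite -dotZl -Pu dot_symm ?tr_horner_mx // -/z z0 dot0r eqxx.
have zE : G *m z = horner_mx G ('X * P) *m b by rewrite horner_mxM_mul horner_mx_X.
rewrite zE /z !dot_horner_mx // -subr_le0 -dotZr -horner_mxZ_mul -dotNr -mulNmx.
rewrite -rmorphN -dotDr -horner_mxD_mul.
set q := _ - _.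
have qE a : q.[a] = L * ((a / L - s ^+ 2) * p.[a / L] ^+ 2).
  rewrite /q hornerD hornerN hornerZ !hornerM hornerX PE; field; by rewrite gt_eqF.
pose b' := b - dot u b *: u.
have bE : b = b' + dot u b *: u by rewrite subrK.
have ub' : dot u b' = 0 by rewrite !dot_lin uu; ring.
have bb' : dot b' b' = dot b b - dot u b ^+ 2 by rewrite !dot_lin uu (dotC b u); ring.
have qu : horner_mx G q *m u = q.[0] *: u.
  by apply: horner_mx_eigenvector; rewrite scale0r.
(* u is an eigenvector of q(G), so no cross terms appear. *)
have ub'q : dot u (horner_mx G q *m b') = 0.
  by rewrite -dot_symm ?tr_horner_mx // qu dotZl ub' mulr0.
have b'q : dot b' (horner_mx G q *m b') <= L * (1 - s ^+ 2) * dot b' b'.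
  rewrite -dotZr -(horner_mxC_mul G); apply: horner_mx_form_le => // a /eigG/andP[_ aL].
  by rewrite hornerC qE ler_pM2l // p_le // ler_pdivrMr // mul1r.
have -> : dot b (horner_mx G q *m b) = dot b' (horner_mx G q *m b') + dot u b ^+ 2 * q.[0].
  rewrite {1 2}bE mulmxDr -scalemxAr qu dotDl !(dotDr, dotZl, dotZr) ub'q uu (dotC b' u) ub'.
  ring.
have q0 : q.[0] = - L * (s ^+ 2 * p.[0] ^+ 2) by rewrite qE mul0r; ring.
move: b'q; rewrite bb' q0; move: main => /(ltW) /(ler_wpM2l (ltW L0)); lra.
Qed.

(** The roots -p + w and -p - w have product -q <= 0, so one of them has the sign required by g;
    each has modulus at most 2 w. *)
Lemma chord (R : rcfType) (p q g : R) : 0 <= q ->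
  exists a, [/\ a ^+ 2 + 2 * a * p = q, a * g <= 0 & a ^+ 2 <= 4 * (p ^+ 2 + q)].
Proof.
move=> q0; have D0 : 0 <= p ^+ 2 + q by rewrite addr_ge0 // sqr_ge0.
set w := Num.sqrt (p ^+ 2 + q); have w0 : 0 <= w := sqrtr_ge0 _.
have ww : w ^+ 2 = p ^+ 2 + q by rewrite sqr_sqrtr.
have [pw1 pw2] : p <= w /\ - p <= w by split; nra.
have [g0|g0] := leP g 0.
  by exists (w - p); split; nra.
by exists (- w - p); split; nra.
Qed.

(** * The sublinear rate *)

Lemma shifted_mem_krylov (R : realType) (d : nat) (A : 'M[R]_d.+1)
    (b : 'cV[R]_d.+1) (c : R) (p : {poly R}) (t : nat) :
  (size p <= t)%N -> horner_mx (A - c%:M) p *m b \in krylov A b t.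
Proof.
move=> sp; rewrite horner_mx_shift horner_mx_mem_krylov //.
by rewrite size_comp_poly2 // size_XsubC.
Qed.

(** [chord] picks the intersection with the sphere where the linear term does not increase.
    Cauchy-Schwarz gives a^2 |z|^2 <= 4 rad^2, so the quadratic term costs at most 2 rad^2 e. *)
Lemma extend_to_sphere (R : realType) (d : nat) (G : 'M[R]_d)
    (b y z : 'cV[R]_d) (rad e : R) :
  G^T = G -> dot y y <= rad ^+ 2 -> 0 < dot z z ->
  dot z (G *m z) <= e * dot z z -> 0 <= e ->
  exists a, let x := y + a *: z in
    dot x x = rad ^+ 2 /\ qobj G b x <= qobj G b y + 2 * rad ^+ 2 * e.
Proof.
move=> symG yr z0 ze e0; set Z := dot z z in z0 ze *.
have q0 : 0 <= (rad ^+ 2 - dot y y) / Z by rewrite divr_ge0 ?subr_ge0 // ltW.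
have [a [aE ag a4]] := chord (dot y z / Z) (dot (G *m y + b) z) q0.
have {}aE : a ^+ 2 * Z + 2 * a * dot y z = rad ^+ 2 - dot y y.
  move: aE => /(congr1 (fun r => r * Z)); rewrite divfK ?gt_eqF // => <-.
  by field; rewrite gt_eqF.
have {}a4 : a ^+ 2 * Z <= 4 * rad ^+ 2.
  move: a4; rewrite -(ler_pM2r z0) => /le_trans; apply.
  have -> : 4 * ((dot y z / Z) ^+ 2 + (rad ^+ 2 - dot y y) / Z) * Z =
      4 * (dot y z ^+ 2 / Z + (rad ^+ 2 - dot y y)) by field; rewrite gt_eqF.
  have : dot y z ^+ 2 / Z <= dot y y by rewrite ler_pdivrMr // cauchy_schwarz.
  lra.
exists a; split.
  by rewrite !dot_lin (dotC z y) -/Z; move: aE; lra.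
rewrite qobjD // -scalemxAr !dot_lin.
have : a ^+ 2 * dot z (G *m z) <= a ^+ 2 * (e * Z) by rewrite ler_wpM2l ?sqr_ge0.
have : a ^+ 2 * Z * e <= 4 * rad ^+ 2 * e by rewrite ler_wpM2r.
move: ag; rewrite dotDl; lra.
Qed.

(* Any L > 0 bounding the spread of the spectrum is allowed, so that the case
   lmax = lmin follows by letting L tend to 0. *)
Lemma sublinear_bound_L (R : realType) (d : nat) (A : 'M[R]_d.+1)
    (b u xstar s : 'cV[R]_d.+1) (rad lmin lam L : R) (t : nat) :
  A^T = A -> 0 < rad -> 0 < L ->
  (forall a, eigenvalue A a -> lmin <= a <= lmin + L) ->
  A *m u = lmin *: u -> dot u u = 1 ->
  is_argmin (fun x => enorm x <= rad) (qobj A b) xstar ->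
  is_multiplier A b rad lmin xstar lam ->
  is_argmin (fun x => x \in krylov A b t /\ enorm x <= rad) (qobj A b) s ->
  (0 < t)%N -> ~~ ((lmin < 0) && (dot u b == 0)) ->
  qobj A b s - qobj A b xstar <=
    L * (enorm xstar ^+ 2 / (t%:R - 2^-1) ^+ 2 *
        (4 + (lmin < 0)%R%:R / 8 * ln (4 * enorm b ^+ 2 / dot u b ^+ 2) ^+ 2)).
Proof.
move=> symA rad0 L0 eigA Au uu [xr xmin] [xE lam_ge lamr] [[sK sr] smin] t0 ub.
have th0 := sub_half_gt0 R t0.
have rad_ge0 := ltW rad0.
rewrite enorm_le // in xr.
have smin' y : y \in krylov A b t -> dot y y <= rad ^+ 2 -> qobj A b s <= qobj A b y.
  by move=> yK yr; apply: smin; rewrite enorm_le.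
have xmin' y : dot y y <= rad ^+ 2 -> qobj A b xstar <= qobj A b y.
  by move=> yr; apply: xmin; rewrite enorm_le.
rewrite !enorm_sqr.
pose G := A - lmin%:M.
have symG : G^T = G by rewrite /G linearB /= tr_scalar_mx symA.
have eigG a : eigenvalue G a -> 0 <= a <= L.
  by move=> /eigenvalue_shift/eigA; rewrite lerDr addrC lerD2l.
have GX : G = horner_mx G 'X by rewrite horner_mx_X.
have G_ge0 x : 0 <= dot x (G *m x).
  by rewrite GX; apply: horner_mx_psd => // a /eigG/andP[? _]; rewrite hornerX.
have G_leL x : dot x (G *m x) <= L * dot x x.
  rewrite {1}GX -dotZr -(horner_mxC_mul G); apply: horner_mx_form_le => // a /eigG/andP[_ ?].
  by rewrite hornerX hornerC.
have GE x : qobj G b x = qobj A b x - lmin / 2 * dot x x.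
  by rewrite /qobj mulmxBl mul_scalar_mx !dot_lin; field.
have Gu : G *m u = 0 by rewrite mulmxBl mul_scalar_mx Au subrr.
have X0 := dot_ge0 xstar.
(* Uses (t - 1/2)^2 <= 2 t (t + 2), with D <= 0 treated apart. *)
have accel (D : R) : t%:R * (t%:R + 2) * D <= 2 * L * dot xstar xstar ->
    D <= L * (dot xstar xstar / (t%:R - 2^-1) ^+ 2 * 4).
  have t1 : 1 <= t%:R :> R by rewrite ler1n.
  move=> H; rewrite (_ : L * _ = L * dot xstar xstar * 4 / (t%:R - 2^-1) ^+ 2); last by ring.
  rewrite ler_pdivlMr ?exprn_gt0 //.
  have [D0|D0] := leP D 0.
    apply: (@le_trans _ _ 0); first by rewrite mulr_le0_ge0 ?sqr_ge0.
    by rewrite !mulr_ge0 // ltW.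
  have : D * (t%:R - 2^-1) ^+ 2 <= D * (2 * (t%:R * (t%:R + 2))).
    by rewrite ler_pM2l //; nra.
  lra.
have [lmin0|lmin0] := ltP lmin 0; last first.
  (* With mu = lmin the accelerated objective is the original one. *)
  have FE x : qobj G b x + lmin / 2 * dot x x = qobj A b x by rewrite GE subrK.
  have [x xr'|p [sp pr]] := @accelerated_bound R d G b xstar L lmin rad t
    symG L0 lmin0 rad0 G_ge0 G_leL xr.
    by rewrite !FE xmin'.
  rewrite !FE => /(accel _) H; rewrite mul0r mul0r addr0; apply: le_trans H.
  by rewrite lerD2r smin' // shifted_mem_krylov.
rewrite lmin0 /= in ub; rewrite mulr1n.
have lamp : 0 < lam by apply: lt_le_trans lam_ge; rewrite lt_max oppr_gt0 lmin0.
have lam_lmin : 0 <= lmin + lam.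
  by move: lam_ge; rewrite ge_max => /andP[? _]; lra.
(* lam > 0, so complementarity puts [xstar] on the sphere. *)
have xrad : dot xstar xstar = rad ^+ 2.
  move/eqP: lamr; rewrite mulf_eq0 gt_eqF //= subr_eq0 => /eqP ->.
  by rewrite enorm_sqr.
have [x xr'|p [sp pr]] := @accelerated_bound R d G b xstar L 0 rad t
    symG L0 (lexx 0) rad0 G_ge0 G_leL xr.
  (* lmin + lam >= 0 is a multiplier for G, so [xstar] also minimises the convex objective over the
     ball. *)
  have xGE : (G + (lmin + lam)%:M) *m xstar = - b.
    by rewrite raddfD addrA subrK.
  rewrite !mul0r !addr0 -subr_ge0 (qobj_gap _ symG xGE).
  rewrite mulmxDl mul_scalar_mx dotDr dotZr addr_ge0 // mulr_ge0 ?invr_ge0 //.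
  - by rewrite addr_ge0 // mulr_ge0 // dot_ge0.
  - by rewrite divr_ge0.
  - by rewrite xrad subr_ge0.
rewrite !mul0r !addr0 => /(accel _) H.
have [q [sq z0 zq]] := lanczos_bound symG L0 eigG Gu uu ub t0.
have e0 : 0 <= L * (ln (4 * dot b b / dot u b ^+ 2) ^+ 2 / (16 * (t%:R - 2^-1) ^+ 2)).
  by rewrite mulr_ge0 ?(ltW L0) // divr_ge0 ?sqr_ge0 // mulr_ge0 ?sqr_ge0.
have [a [x2 xle]] := extend_to_sphere b symG pr z0 zq e0.
set x := horner_mx G p *m b + _ in x2 xle.
have sx : qobj A b s <= qobj A b x.
  by apply: smin'; rewrite ?x2 // memvD ?memvZ // shifted_mem_krylov.
(* Both points lie on the sphere, where the two objectives differ by a constant. *)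
have : qobj A b x - qobj A b xstar = qobj G b x - qobj G b xstar.
  by rewrite !GE x2 xrad; ring.
move: xle H; rewrite -xrad; set l := ln _.
set X := dot xstar xstar.
have -> : 2 * X * (L * (l ^+ 2 / (16 * (t%:R - 2^-1) ^+ 2))) =
    L * (X / (t%:R - 2^-1) ^+ 2 * (1 / 8 * l ^+ 2)).
  by set h := _ - 2^-1 in th0 *; field; rewrite gt_eqF.
rewrite [L * (_ * (4 + _))](_ : _ = L * (X / (t%:R - 2^-1) ^+ 2 * 4) +
  L * (X / (t%:R - 2^-1) ^+ 2 * (1 / 8 * l ^+ 2))); last by ring.
lra.
Qed.

Lemma sublinear_rate_bound (R : realType) (d : nat) (A : 'M[R]_d.+1)
    (b u xstar s : 'cV[R]_d.+1) (rad lmin lmax lam : R) (t : nat) :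
  A^T = A -> 0 < rad -> lmin <= lmax ->
  (forall a, eigenvalue A a -> lmin <= a <= lmax) ->
  is_unit_eigenvector A lmin u ->
  is_argmin (fun x => enorm x <= rad) (qobj A b) xstar ->
  is_multiplier A b rad lmin xstar lam ->
  is_argmin (fun x => x \in krylov A b t /\ enorm x <= rad) (qobj A b) s ->
  (0 < t)%N ->
  ((qobj A b s - qobj A b xstar)%:E <= sublinear_bound b xstar u lmin lmax t)%E.
Proof.
move=> symA rad0 lmM eigA [Au u1] xmin xmult smin t0; rewrite /sublinear_bound.
case: ifPn => [_|ub]; first by rewrite leey.
have uu : dot u u = 1 by rewrite -enorm_sqr u1 expr1n.
rewrite lee_fin; set C := 4 + _.
set K := enorm xstar ^+ 2 / (t%:R - 2^-1) ^+ 2 * C.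
rewrite (_ : _ * C = (lmax - lmin) * K); last by rewrite /K; ring.
have bound L : 0 < L -> lmax - lmin <= L -> qobj A b s - qobj A b xstar <= L * K.
  move=> L0 lL; apply: (sublinear_bound_L symA rad0 L0 _ Au uu xmin xmult smin t0 ub).
  by move=> a /eigA/andP[-> a2] /=; lra.
have [e|lmM'] := eqVneq lmax lmin; last first.
  by apply: bound => //; rewrite subr_gt0 lt_neqAle eq_sym lmM'.
rewrite e subrr in bound *; rewrite mul0r leNgt; apply/negP => gap0.
have K0 : 0 < K by have := bound 1 ltr01 ler01; lra.
(* With this L the bound would be half of the positive gap. *)
pose L := (qobj A b s - qobj A b xstar) / (2 * K).
have L0 : 0 < L by rewrite divr_gt0 // mulr_gt0.
have := bound L L0 (ltW L0).
have -> : L * K = (qobj A b s - qobj A b xstar) / 2 by rewrite /L; field; rewrite gt_eqF.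
lra.
Qed.

Theorem theorem1 (R : realType) (d : nat) (A : 'M[R]_d) (b : 'cV[R]_d)
    (rad : R) (lmin lmax : R) (umin xstar : 'cV[R]_d) (lam : R)
    (hA : A^T = A) (hrad : 0 < rad)
    (hlmin : is_lambda_min A lmin) (hlmax : is_lambda_max A lmax)
    (humin : is_unit_eigenvector A lmin umin)
    (hxstar : is_argmin (fun x => enorm x <= rad) (qobj A b) xstar)
    (hlam : is_multiplier A b rad lmin xstar lam)
    (t : nat) (ht : (1 <= t)%N) (s : 'cV[R]_d)
    (hs : is_argmin (fun x => x \in krylov A b t /\ enorm x <= rad)
            (qobj A b) s) :
  qobj A b s - qobj A b xstar <=
    36 * (qobj A b 0 - qobj A b xstar) * linear_rate lmin lmax lam t
  /\ ((qobj A b s - qobj A b xstar)%:E <=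
        sublinear_bound b xstar umin lmin lmax t)%E.
Proof.
case: hlmin hlmax => lminA lmin_le [lmaxA le_lmax].
have eigA a : eigenvalue A a -> lmin <= a <= lmax.
  by move=> aA; rewrite lmin_le // le_lmax.
have lmM : lmin <= lmax := lmin_le _ lmaxA.
case: d => [|d] in A b umin xstar hA humin hxstar hlam s hs
  lminA lmin_le lmaxA le_lmax eigA *.
  (* In dimension 0 there is no nonzero eigenvector. *)
  have /eigenvalueP[v _] := lminA.
  by rewrite flatmx0 thinmx0 eqxx.
split; last exact: sublinear_rate_bound hA hrad lmM eigA humin hxstar hlam hs ht.
have [xE] := hlam; rewrite ge_max => /andP[lam1 lam0] _.
have lmin_lam : 0 <= lmin + lam by lra.
exact: (linear_rate_bound hA eigA lmM hxstar.1 xE lmin_lam lam0 ht hs.2).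
Qed.
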